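(* For each homeomorphism $g\in \mathrm{Aut}(\mathbb{S}^1)$, let $\pi(g)$ be the automorphism of the circle graph $\mathcal{C}$ that maps the chord with endpoints $x,y$ to the chord with endpoints $g(x),g(y)$, for all distinct $x,y\in\mathbb{S}^1$. Then the map $\pi$ is a group isomorphism from $\mathrm{Aut}(\mathbb{S}^1)$ onto $\mathrm{Aut}(\mathcal{C})$.
   Context: $\mathbb{S}^1$ is the unit circle in $\mathbb{R}^2$, and $\mathrm{Aut}(\mathbb{S}^1)$ is the group of all homeomorphisms of $\mathbb{S}^1$ onto itself (orientation-preserving or not), under composition. A chord of $\mathbb{S}^1$ is a (closed) straight line segment joining two distinct points of $\mathbb{S}^1$. The circle graph $\mathcal{C}$ is the graph whose vertices are all chords of $\mathbb{S}^1$, in which two distinct chords are joined by an edge if and only if they intersect (either at a point of $\mathbb{S}^1$ or at a point inside it). For a graph $G$, $\mathrm{Aut}(G)$ denotes its automorphism group, i.e. the group of bijections of the vertex set preserving adjacency and non-adjacency. *)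

(* Defs.v *)
From HB Require Import structures.
From mathcomp Require Import all_boot all_order all_algebra.
From mathcomp Require Import all_classical all_reals all_analysis.

Set Implicit Arguments.
Unset Strict Implicit.
Unset Printing Implicit Defensive.

Import Order.TTheory GRing.Theory Num.Theory.
Import numFieldNormedType.Exports.

Local Open Scope classical_set_scope.
Local Open Scope ring_scope.

Section Bijections.
Variable T : choiceType.

Record bijection : Type := Bijection {
  bij_fun :> T -> T;
  bij_funP : `[< bijective bij_fun >]
}.

HB.instance Definition _ := [isSub for bij_fun].
HB.instance Definition _ := [Choice of bijection by <:].

Implicit Types f g : bijection.

Lemma bij_bijective f : bijective f.
Proof. exact/asboolP/bij_funP. Qed.

Lemma bijectionP f g : (forall x, f x = g x) -> f = g.
Proof. by move=> fg; apply/val_inj/funext. Qed.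

Definition bij_one : bijection :=
  @Bijection idfun (asboolT (Bijective (frefl _) (frefl _))).

(* (f * g)(x) = f (g x). *)
Definition bij_mul f g : bijection :=
  @Bijection (f \o g) (asboolT (bij_comp (bij_bijective f) (bij_bijective g))).

Lemma bij_inv_subproof f : exists g : T -> T, cancel f g /\ cancel g f.
Proof. by have [g fK gK] := bij_bijective f; exists g. Qed.

Definition bij_inv_fun f : T -> T := projT1 (cid (bij_inv_subproof f)).

Lemma bij_invK f : cancel (bij_inv_fun f) f.
Proof. by have [] := projT2 (cid (bij_inv_subproof f)). Qed.

Lemma bij_funK f : cancel f (bij_inv_fun f).
Proof. by have [] := projT2 (cid (bij_inv_subproof f)). Qed.

Definition bij_inv f : bijection :=
  @Bijection (bij_inv_fun f) (asboolT (Bijective (bij_invK f) (bij_funK f))).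

Lemma bij_mulA : associative bij_mul.
Proof. by move=> f g h; apply: bijectionP. Qed.

Lemma bij_mul1f : left_id bij_one bij_mul.
Proof. by move=> f; apply: bijectionP. Qed.

Lemma bij_mulf1 : right_id bij_one bij_mul.
Proof. by move=> f; apply: bijectionP. Qed.

Lemma bij_mulVf : left_inverse bij_one bij_inv bij_mul.
Proof. by move=> f; apply: bijectionP; exact: bij_funK. Qed.

Lemma bij_mulfV : right_inverse bij_one bij_inv bij_mul.
Proof. by move=> f; apply: bijectionP; exact: bij_invK. Qed.

HB.instance Definition _ := isGroup.Build bijection
  bij_mulA bij_mul1f bij_mulf1 bij_mulVf bij_mulfV.

End Bijections.

Section Homeomorphisms.
Variable T : topologicalType.

Definition is_homeo : pred (bijection T) :=
  fun f => `[< continuous f /\ continuous (f^-1)%g >].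

Lemma is_homeo_group_closed : group_closed is_homeo.
Proof.
split; first by apply/asboolP; rewrite invg1; split=> x; exact: cvg_id.
move=> f g /asboolP[cf cVf] /asboolP[cg cVg]; apply/asboolP; split.
  by move=> x; exact: (continuous_comp (cVg x) (cf _)).
rewrite invgM invgK => x.
exact: (continuous_comp (cVf x) (cg _)).
Qed.

Record homeo : Type := Homeo {
  homeo_bij :> bijection T;
  homeo_bijP : is_homeo homeo_bij
}.

HB.instance Definition _ := [isSub for homeo_bij].
HB.instance Definition _ := [Choice of homeo by <:].
HB.instance Definition _ :=
  SubChoice_isSubGroup.Build _ _ homeo is_homeo_group_closed.

End Homeomorphisms.

Record graph : Type := Graph {
  vertex : choiceType;
  adj : vertex -> vertex -> Prop;
  adj_sym : forall u v, adj u v -> adj v u;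
  adj_irrefl : forall v, ~ adj v v
}.

Section GraphAutomorphisms.
Variable G : graph.

Definition is_graph_aut : pred (bijection (vertex G)) :=
  fun f => `[< forall u v, adj (f u) (f v) <-> adj u v >].

Lemma is_graph_aut_group_closed : group_closed is_graph_aut.
Proof.
split; first exact/asboolP.
move=> f g /asboolP Af /asboolP Ag; apply/asboolP => u v.
apply: iff_trans (Af _ _) _; apply: iff_trans (iff_sym (Ag _ _)) _.
by rewrite !(bij_invK g).
Qed.

Record graph_aut : Type := GraphAut {
  graph_aut_bij :> bijection (vertex G);
  graph_aut_bijP : is_graph_aut graph_aut_bij
}.

HB.instance Definition _ := [isSub for graph_aut_bij].
HB.instance Definition _ := [Choice of graph_aut by <:].
HB.instance Definition _ :=
  SubChoice_isSubGroup.Build _ _ graph_aut is_graph_aut_group_closed.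

End GraphAutomorphisms.

Definition group_isomorphism (G H : groupType) (phi : G -> H) : Prop :=
  {morph phi : g h / (g * h)%g} /\ bijective phi.

Section CircleGraph.
Variable R : realType.

(* R^o is R as a module over itself; the product carries the usual topology
   of the Euclidean plane. *)
Local Notation plane := (R^o * R^o)%type.

Definition unit_circle : set plane := [set p | p.1 ^+ 2 + p.2 ^+ 2 = 1].

(* The unit circle with the topology induced from the plane. *)
Definition S1 : topologicalType := set_type unit_circle.

Definition segment (p q : plane) : set plane :=
  [set (1 - t) *: p + t *: q | t in `[0, 1]].

Definition is_chord : set (set plane) :=
  [set c | exists p q, [/\ unit_circle p, unit_circle q, p <> q &
                          c = segment p q]].

Definition chord : choiceType := set_type is_chord.

Definition has_endpoints (c : chord) (x y : S1) : Prop :=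
  x <> y /\ val c = segment (val x) (val y).

Definition chord_adj (c d : chord) : Prop :=
  c <> d /\ val c `&` val d !=set0.

Lemma chord_adj_sym c d : chord_adj c d -> chord_adj d c.
Proof. by move=> [cd cId]; split; [exact/nesym|rewrite setIC]. Qed.

Lemma chord_adj_irrefl c : ~ chord_adj c c.
Proof. by case. Qed.

Definition circle_graph : graph := Graph chord_adj_sym chord_adj_irrefl.

(* Well defined only if each g induces a graph automorphism, which is why it
   is a property of [pi] rather than a construction. *)
Definition induced_on_chords
    (pi : homeo S1 -> graph_aut circle_graph) : Prop :=
  forall (g : homeo S1) (x y : S1) (c : chord),
    has_endpoints c x y -> has_endpoints (pi g c) (g x) (g y).

End CircleGraph.

(* Main.v *)
(* Two chords [xy] and [zw] meet iff [z] and [w] are not strictly on the same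
   side of the line [xy]. The arcs cut off by two points are connected, so a
   homeomorphism preserves this relation.

   Conversely, say that [d] and [e] cover [c] when every chord meeting [c] meets
   [d] or [e], a property invariant under graph automorphisms. In a triangle any
   two sides cover the third, because a line meeting one side meets another one;
   and if [d] and [e] cover [c], then each endpoint of [c] belongs to [d] or [e].
   Hence automorphisms preserve the property of sharing an endpoint, and map all
   chords at one point to chords at one point, which gives a bijection of the
   circle. It preserves sides of chords, and open arcs form a basis of the
   topology, so it is a homeomorphism. *)

Require Import Defs.
From mathcomp Require Import all_boot all_order all_algebra.
From mathcomp Require Import all_classical all_reals all_analysis.
From mathcomp Require Import ring lra.

Set Implicit Arguments.
Unset Strict Implicit.
Unset Printing Implicit Defensive.

Import Order.TTheory GRing.Theory Num.Theory.
Import numFieldNormedType.Exports.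

Local Open Scope classical_set_scope.
Local Open Scope ring_scope.

(** * Orientation in the plane and intersection of chords *)

Section PlaneGeometry.
Variable R : realType.
Local Notation plane := (R^o * R^o)%type.
Implicit Types p q x y z w : plane.

(** Twice the signed area of the triangle [x y z]; its sign tells the side of the line [xy] on which
    [z] lies. *)
Definition orient x y z : R :=
  (y.1 - x.1) * (z.2 - x.2) - (y.2 - x.2) * (z.1 - x.1).

Definition sqdist x y : R := (x.1 - y.1) ^+ 2 + (x.2 - y.2) ^+ 2.

Lemma plane_eq x y : x.1 = y.1 -> x.2 = y.2 -> x = y.
Proof. by case: x y => [? ?] [? ?] /= -> ->. Qed.

Lemma sqdist_gt0 x y : x <> y -> 0 < sqdist x y.
Proof.
move=> xy; rewrite lt_neqAle addr_ge0 ?sqr_ge0// andbT eq_sym.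
apply/eqP => /eqP; rewrite paddr_eq0 ?sqr_ge0// !sqrf_eq0 !subr_eq0.
by move=> /andP[/eqP ? /eqP ?]; apply/xy/plane_eq.
Qed.

Lemma segmentP x y p : segment x y p <->
  exists t : R, [/\ 0 <= t <= 1, p.1 = (1 - t) * x.1 + t * y.1 &
                    p.2 = (1 - t) * x.2 + t * y.2].
Proof.
split=> [[t /=]|[t [t01 p1 p2]]].
  by rewrite in_itv/= => t01 <-; exists t.
by exists t; rewrite /= ?in_itv//; apply: plane_eq.
Qed.

Lemma segmentC x y : segment x y = segment y x.
Proof.
apply/seteqP; split=> p /segmentP[t [t01 p1 p2]]; apply/segmentP; exists (1 - t);
  by split; [lra|rewrite p1; ring|rewrite p2; ring].
Qed.

Lemma segment_left x y : segment x y x.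
Proof. by apply/segmentP; exists 0; split; [lra|ring|ring]. Qed.

Lemma orientxxy x y : orient x x y = 0.
Proof. by rewrite /orient; ring. Qed.

Lemma orientxyx x y : orient x y x = 0.
Proof. by rewrite /orient; ring. Qed.

Lemma orientxyy x y : orient x y y = 0.
Proof. by rewrite /orient; ring. Qed.

Lemma orient_affine x y z w p t :
  p.1 = (1 - t) * z.1 + t * w.1 -> p.2 = (1 - t) * z.2 + t * w.2 ->
  orient x y p = (1 - t) * orient x y z + t * orient x y w.
Proof. by rewrite /orient => -> ->; ring. Qed.

(* The parameter is that of the orthogonal projection of [p] on the line [xy]. *)
Lemma orient_eq0_line x y p : x <> y -> orient x y p = 0 ->
  exists t : R, p.1 = (1 - t) * x.1 + t * y.1 /\ p.2 = (1 - t) * x.2 + t * y.2.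
Proof.
move=> /sqdist_gt0; rewrite /orient /sqdist => D0 o0.
set D := (X in 0 < X) in D0.
pose t := ((p.1 - x.1) * (y.1 - x.1) + (p.2 - x.2) * (y.2 - x.2)) / D.
have Dn0 : D != 0 by rewrite gt_eqF.
have tD : t * D = (p.1 - x.1) * (y.1 - x.1) + (p.2 - x.2) * (y.2 - x.2).
  by rewrite /t divfK.
exists t; split; apply: (mulIf Dn0).
- transitivity (D * x.1 + (t * D) * (y.1 - x.1)); last by ring.
  rewrite tD; apply/eqP; rewrite -subr_eq0; apply/eqP.
  transitivity (- (y.2 - x.2) * ((y.1 - x.1) * (p.2 - x.2) - (y.2 - x.2) * (p.1 - x.1))).
    by rewrite /D; ring.
  by rewrite o0 mulr0.
- transitivity (D * x.2 + (t * D) * (y.2 - x.2)); last by ring.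
  rewrite tD; apply/eqP; rewrite -subr_eq0; apply/eqP.
  transitivity ((y.1 - x.1) * ((y.1 - x.1) * (p.2 - x.2) - (y.2 - x.2) * (p.1 - x.1))).
    by rewrite /D; ring.
  by rewrite o0 mulr0.
Qed.

(** Power of a point: on the line of a chord, [t * (1 - t)] is nonnegative exactly in the closed
    disk and vanishes exactly on the circle. *)
Lemma sqnorm_affine x y p t : unit_circle x -> unit_circle y ->
  p.1 = (1 - t) * x.1 + t * y.1 -> p.2 = (1 - t) * x.2 + t * y.2 ->
  p.1 ^+ 2 + p.2 ^+ 2 = 1 - t * (1 - t) * sqdist x y.
Proof.
rewrite /unit_circle/= /sqdist => ux uy -> ->.
transitivity ((1 - t) * (x.1 ^+ 2 + x.2 ^+ 2) + t * (y.1 ^+ 2 + y.2 ^+ 2)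
  - t * (1 - t) * ((x.1 - y.1) ^+ 2 + (x.2 - y.2) ^+ 2)); first by ring.
by rewrite ux uy; ring.
Qed.

Lemma orient_eq0 x y z : unit_circle x -> unit_circle y -> unit_circle z ->
  x <> y -> orient x y z = 0 -> z = x \/ z = y.
Proof.
move=> ux uy uz xy /(orient_eq0_line xy)[t [z1 z2]].
have := sqnorm_affine ux uy z1 z2; rewrite uz => /eqP.
rewrite eq_sym addrC -subr_eq0 addrK oppr_eq0 !mulf_eq0 (gt_eqF (sqdist_gt0 xy)) orbF.
case/orP => /eqP t0; [left|right]; apply: plane_eq; rewrite ?z1 ?z2.
- by rewrite t0; ring.
- by rewrite t0; ring.
- by rewrite (_ : t = 1); [ring|lra].
- by rewrite (_ : t = 1); [ring|lra].
Qed.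

Lemma segment_circle x y z : unit_circle x -> unit_circle y -> unit_circle z ->
  x <> y -> segment x y z -> z = x \/ z = y.
Proof.
move=> ux uy uz xy /segmentP[t [_ z1 z2]]; apply: orient_eq0 => //.
by rewrite (orient_affine _ _ z1 z2) orientxyx orientxyy; ring.
Qed.

Lemma segment_meet x y z w :
  unit_circle x -> unit_circle y -> unit_circle z -> unit_circle w ->
  x <> y -> z <> w ->
  (segment x y `&` segment z w !=set0) <->
  orient x y z * orient x y w <= 0.
Proof.
move=> ux uy uz uw xy zw; split.
  move=> [p [/segmentP[t [t01 p1 p2]] /segmentP[u [u01 q1 q2]]]].
  have := orient_affine x y q1 q2.
  rewrite (orient_affine x y p1 p2) orientxyx orientxyy => o0.
  set a := orient x y z in o0 *; set b := orient x y w in o0 *.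
  (* If [a * b > 0], multiplying the vanishing [(1 - u) * a + u * b] by [a] yields a convex
     combination of two positive numbers equal to zero. *)
  rewrite leNgt; apply/negP => ab.
  have : 0 = (1 - u) * (a * a) + u * (a * b).
    by transitivity (a * ((1 - u) * a + u * b)); [rewrite -o0|]; ring.
  have a0 : 0 < a * a.
    by rewrite -expr2 exprn_even_gt0//=; apply: contraTneq ab => ->; rewrite mul0r ltxx.
  have : 0 < (1 - u) * (a * a) + u * (a * b).
    have /andP[u0 u1] := u01; have [->|un0] := eqVneq u 0; first by lra.
    rewrite ltr_wpDl//; first by rewrite mulr_ge0 ?subr_ge0 ?(ltW a0).
    by rewrite mulr_gt0// lt_neqAle eq_sym un0.
  lra.
set a := orient x y z; set b := orient x y w => ab0.
(* The zero of the affine function with values [a] at [z] and [b] at [w]. If [a = b], then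
   [a * b <= 0] forces both to vanish, and the default [u = 0] still works. *)
pose u := a / (a - b).
have u01 : 0 <= u <= 1.
  rewrite /u; have [->|abn] := eqVneq (a - b) 0; first by rewrite invr0 mulr0 lexx ler01.
  have d2 : 0 < (a - b) ^+ 2 by rewrite exprn_even_gt0.
  rewrite (_ : a / (a - b) = (a * (a - b)) / (a - b) ^+ 2); last by field.
  rewrite divr_ge0 ?(ltW d2) ?ler_pdivrMr//=; nra.
have uE : (1 - u) * a + u * b = 0.
  rewrite /u; have [abE|abn] := eqVneq (a - b) 0; last by field.
  have : a ^+ 2 = 0.
    by apply/le_anti; rewrite sqr_ge0 andbT expr2 {2}(_ : a = b)//; lra.
  move=> /eqP; rewrite sqrf_eq0 => /eqP a0.
  by rewrite abE invr0 a0 mulr0; lra.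
pose p : plane := ((1 - u) * z.1 + u * w.1, (1 - u) * z.2 + u * w.2).
have op : orient x y p = 0.
  by rewrite (@orient_affine x y z w p u).
exists p; split; last by apply/segmentP; exists u.
have [t [p1 p2]] := orient_eq0_line xy op.
apply/segmentP; exists t; split=> //.
(* Being on the segment [zw], [p] lies in the closed disk; computing its norm along both chords
   gives [0 <= t * (1 - t)], so [p] is on the segment [xy]. *)
have := sqnorm_affine ux uy p1 p2; rewrite (@sqnorm_affine z w p u)// => E.
have := sqdist_gt0 zw; have := sqdist_gt0 xy => D1 D2.
have : 0 <= t * (1 - t) * sqdist x y.
  have : 0 <= u * (1 - u) by nra.
  by move=> /mulr_ge0 /(_ (ltW D2)); lra.
rewrite pmulr_lge0//; nra.
Qed.

End PlaneGeometry.

(** * Rational parametrization and topology of the circle *)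

Section CircleTopology.
Variable R : realType.
Local Notation plane := (R^o * R^o)%type.
Local Notation S1 := (S1 R).
Implicit Types a b x y z w : S1.

Definition orientS x y z : R := orient (val x) (val y) (val z).

Lemma circleP a : unit_circle (val a).
Proof. exact: set_valP. Qed.

Lemma circle_eq a b : val a = val b -> a = b.
Proof. exact: val_inj. Qed.

Lemma val_neq a b : a <> b -> val a <> val b.
Proof. by move=> ab /circle_eq. Qed.

(* The point obtained by rotating [a] by the angle [2 * atan t]; as [t] varies
   this parametrizes the circle minus the antipode of [a]. *)
Definition rot_plane a (t : R) : plane :=
  (((1 - t ^+ 2) * (val a).1 - 2 * t * (val a).2) / (1 + t ^+ 2),
   ((1 - t ^+ 2) * (val a).2 + 2 * t * (val a).1) / (1 + t ^+ 2)).

Lemma sq1_gt0 (t : R) : 0 < 1 + t ^+ 2.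
Proof. by rewrite ltr_pwDl ?sqr_ge0. Qed.

Lemma rot_plane_circle a t : unit_circle (rot_plane a t).
Proof.
have /(_ t) tn0 := sq1_gt0; rewrite /unit_circle/=.
transitivity ((val a).1 ^+ 2 + (val a).2 ^+ 2); last exact: circleP.
by field; rewrite gt_eqF.
Qed.

Definition rot a t : S1 := SigSub (mem_set (rot_plane_circle a t)).

Lemma opp_circle a : unit_circle (- val a : plane).
Proof. by have := circleP a; rewrite /unit_circle/= !sqrrN. Qed.

Definition antipode a : S1 := SigSub (mem_set (opp_circle a)).

Lemma antipodeK : involutive antipode.
Proof. by move=> a; apply/circle_eq; rewrite /= opprK. Qed.

(** The last factor is positive, so chords through the antipode of [a] separate points as their
    parameters are ordered on the real line. *)
Lemma orient_rot_antipode a s t :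
  orientS (antipode a) (rot a s) (rot a t) =
  (t - s) * (4 / ((1 + s ^+ 2) * (1 + t ^+ 2))).
Proof.
rewrite /orientS /orient/=.
transitivity ((t - s) * (4 / ((1 + s ^+ 2) * (1 + t ^+ 2)))
  * ((val a).1 ^+ 2 + (val a).2 ^+ 2)); last by rewrite circleP mulr1.
by field; rewrite !gt_eqF ?sq1_gt0.
Qed.

Lemma rot_surj a z : z <> antipode a -> exists t, z = rot a t.
Proof.
move=> /val_neq /= za.
have az0 : 0 < 1 + ((val a).1 * (val z).1 + (val a).2 * (val z).2).
  have := sqdist_gt0 za; rewrite /sqdist/=.
  have := circleP a; have := circleP z; rewrite /unit_circle/=; lra.
set D := 1 + _ in az0.
(* For the angle [theta] from [a] to [z], [D] is [1 + cos theta] and [d] is [sin theta], so [d / D]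
   is [tan (theta / 2)]. *)
pose d := (val a).1 * (val z).2 - (val a).2 * (val z).1.
have tE : 1 + (d / D) ^+ 2 = 2 / D.
  have : D ^+ 2 + d ^+ 2 = 2 * D.
    transitivity (1 + 2 * (D - 1) + ((val a).1 ^+ 2 + (val a).2 ^+ 2) *
                   ((val z).1 ^+ 2 + (val z).2 ^+ 2)).
      by rewrite /D /d; ring.
    by rewrite (circleP a) (circleP z); ring.
  move=> E; rewrite expr_div_n -(divff (expf_neq0 2 (lt0r_neq0 az0))) -mulrDl E.
  by field; rewrite gt_eqF.
have tE1 : 1 - (d / D) ^+ 2 = (2 * D - 2) / D.
  rewrite (_ : _ - _ = 2 - (1 + (d / D) ^+ 2)); last by ring.
  by rewrite tE; field; rewrite gt_eqF.
have na := circleP a; exists (d / D); apply/circle_eq/plane_eq; rewrite /= tE tE1.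
- transitivity ((val z).1 * ((val a).1 ^+ 2 + (val a).2 ^+ 2)); first by rewrite na mulr1.
  transitivity ((D - 1) * (val a).1 - d * (val a).2); first by rewrite /D /d; ring.
  by field; rewrite gt_eqF.
- transitivity ((val z).2 * ((val a).1 ^+ 2 + (val a).2 ^+ 2)); first by rewrite na mulr1.
  transitivity ((D - 1) * (val a).2 + d * (val a).1); first by rewrite /D /d; ring.
  by field; rewrite gt_eqF.
Qed.

Lemma rot0 a : rot a 0 = a.
Proof.
apply/circle_eq/plane_eq; rewrite /= expr0n/= subr0 addr0 divr1; ring.
Qed.

Lemma val_continuous : continuous (fun a : S1 => val a : plane).
Proof. exact: initial_continuous. Qed.

Lemma circle_continuous (T : topologicalType) (f : T -> S1) :
  continuous (fun t => val (f t) : plane) -> continuous f.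
Proof.
move=> cf t U [V [[W oW <-] /= Wt WU]]; apply: filterS WU _.
by apply: cf; exact: open_nbhs_nbhs.
Qed.

Lemma plane_continuous (T : topologicalType) (f : T -> plane) :
  continuous (fun t => (f t).1) -> continuous (fun t => (f t).2) -> continuous f.
Proof.
move=> c1 c2 t.
rewrite (_ : f = (fun t => ((f t).1, (f t).2))); last by apply/funext => u; case: (f u).
exact: (cvg_pair (c1 t) (c2 t)).
Qed.

Lemma rot_continuous a : continuous (rot a).
Proof.
have den : continuous (fun t : R => (1 + t ^+ 2)^-1 : R).
  move=> t; apply: cvgV; first by rewrite gt_eqF ?sq1_gt0.
  by apply: cvgD; [exact: cvg_cst|exact: exprn_continuous].
have sq : continuous (fun t : R => 1 - t ^+ 2 : R).
  by move=> t; apply: cvgB; [exact: cvg_cst|exact: exprn_continuous].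
have dbl : continuous (fun t : R => 2 * t : R).
  by move=> t; apply: cvgM; [exact: cvg_cst|exact: cvg_id].
apply/circle_continuous/plane_continuous => t; apply: cvgM.
- by apply: cvgB; (apply: cvgM; first [exact: sq|exact: dbl|exact: cvg_cst]).
- exact: den.
- by apply: cvgD; (apply: cvgM; first [exact: sq|exact: dbl|exact: cvg_cst]).
- exact: den.
Qed.

Lemma orient_continuous (p q : plane) : continuous (orient p q).
Proof.
move=> r.
have c1 : (r' : plane).1 @[r' --> r] --> r.1 by exact: cvg_fst.
have c2 : (r' : plane).2 @[r' --> r] --> r.2 by exact: cvg_snd.
by apply: cvgB; (apply: cvgM; first exact: cvg_cst); (apply: cvgB; last exact: cvg_cst).
Qed.

Lemma orientS_continuous x y : continuous (orientS x y).
Proof.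
move=> z; exact: (continuous_comp (@val_continuous z) (@orient_continuous _ _ _)).
Qed.

Lemma same_side_open x y w : open [set z | 0 < orientS x y z * orientS x y w].
Proof.
have c : continuous (fun z => orientS x y z * orientS x y w).
  move=> z.
  exact: (continuous_comp (@orientS_continuous x y z) (@mulrr_continuous R _ _)).
exact: (open_comp (fun z _ => c z) (@open_gt R 0)).
Qed.

Lemma nbhs_arc a (U : set S1) : nbhs a U ->
  exists x y, 0 < orientS x y a /\ forall z, 0 < orientS x y z -> U z.
Proof.
move=> [V [[W oW <-] /= Wa WU]].
have /nbhs_ballP[e /= e0 eW] : nbhs (val a : plane) W by exact: open_nbhs_nbhs.
(* Points beyond the chord from [rot a t] to [rot a (- t)] have squared distance to [a] below
   [4 * t ^+ 2 / (1 + t ^+ 2)], hence below [e ^+ 2]. This order of the endpoints puts [a] on the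
   positive side. *)
pose t := e / 2; have t0 : 0 < t by rewrite divr_gt0.
have t1 := sq1_gt0 t.
exists (rot a t), (rot a (- t)).
have E z : orientS (rot a t) (rot a (- t)) z = 4 * t / (1 + t ^+ 2) *
    (2 * t ^+ 2 / (1 + t ^+ 2) - sqdist (val z) (val a) / 2).
  have sqE : sqdist (val z) (val a) / 2 = 1 - ((val z).1 * (val a).1 + (val z).2 * (val a).2).
    have := circleP a; have := circleP z; rewrite /unit_circle/sqdist/=; lra.
  transitivity (4 * t / (1 + t ^+ 2) * ((val z).1 * (val a).1 + (val z).2 * (val a).2
      - (1 - t ^+ 2) / (1 + t ^+ 2) * ((val a).1 ^+ 2 + (val a).2 ^+ 2))).
    by rewrite /orientS /orient/=; field; rewrite gt_eqF.
  by rewrite sqE (circleP a); field; rewrite gt_eqF.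
have tt0 : 0 < 4 * t / (1 + t ^+ 2) by rewrite divr_gt0// mulr_gt0.
split.
  rewrite E mulr_gt0// (_ : sqdist _ _ = 0); last by rewrite /sqdist !subrr expr0n addr0.
  by rewrite mul0r subr0 divr_gt0// mulr_gt0// exprn_gt0.
move=> z; rewrite E pmulr_rgt0// => h.
apply: WU; apply: eW.
have : sqdist (val z) (val a) < e ^+ 2.
  have : 2 * t ^+ 2 / (1 + t ^+ 2) <= 2 * t ^+ 2.
    rewrite ler_pdivrMr//; apply: ler_peMr; last by rewrite lerDl sqr_ge0.
    by rewrite mulr_ge0 ?sqr_ge0.
  by move: h; rewrite (_ : e = 2 * t) ?exprMn; [lra|rewrite /t; field].
rewrite /sqdist => d.
have lt_coord (u v : R) : u ^+ 2 + v ^+ 2 < e ^+ 2 -> `|u| < e.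
  move=> uv; rewrite -(@ltr_pXn2r _ 2) ?nnegrE ?(ltW e0)// real_normK ?num_real//.
  by apply: le_lt_trans uv; rewrite lerDl sqr_ge0.
by split; rewrite /ball/= distrC; [exact: lt_coord d|apply: lt_coord; rewrite addrC; exact: d].
Qed.

Lemma nbhs_neq a (U : set S1) : nbhs a U -> exists2 b, b <> a & U b.
Proof.
rewrite -{1}(rot0 a) => /rot_continuous /nbhs_ballP[e /= e0 eU].
exists (rot a (e / 2)); last first.
  by apply: eU; rewrite /ball/= sub0r normrN gtr0_norm ?divr_gt0// gtr_pMr// invf_lt1// ltr1n.
have := orient_rot_antipode a 0 (e / 2); rewrite rot0 => E ba.
move: E; rewrite ba /orientS orientxyy subr0 => /eqP.
by rewrite eq_sym gt_eqF// mulr_gt0// ?divr_gt0// mulr_gt0 ?sq1_gt0.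
Qed.

End CircleTopology.

(** * Sides of chords and continuity *)

Section SeparationOfTheCircle.
Variable R : realType.
Local Notation S1 := (S1 R).
Implicit Types a b x y z w : S1.

Lemma orientS_eq0 x y z : x <> y -> orientS x y z = 0 -> z = x \/ z = y.
Proof.
move=> /val_neq xy /(orient_eq0 (circleP x) (circleP y) (circleP z) xy).
by case=> /circle_eq ->; [left|right].
Qed.

Lemma orientS_neq0 x y z : x <> y -> z <> x -> z <> y -> orientS x y z != 0.
Proof. by move=> xy zx zy; apply/eqP => /(orientS_eq0 xy)[]. Qed.

Lemma orientS_gt0_neq x y z w : 0 < orientS x y z * orientS x y w ->
  [/\ x <> y, z <> x & z <> y].
Proof.
move=> h; split=> E; move: h; 
  by rewrite E /orientS ?orientxxy ?orientxyx ?orientxyy mul0r ltxx.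
Qed.

Lemma rot_inj a : injective (rot a).
Proof.
move=> s t st; have := orient_rot_antipode a s t.
rewrite -st /orientS orientxyy => /esym/eqP.
have w0 : 0 < 4 / ((1 + s ^+ 2) * (1 + t ^+ 2)) by rewrite divr_gt0// mulr_gt0 ?sq1_gt0.
by rewrite mulf_eq0 subr_eq0 (gt_eqF w0) orbF => /eqP ->.
Qed.

Lemma circle_three_points a : exists b c, [/\ b <> a, c <> a & b <> c].
Proof.
exists (rot a 1), (rot a 2); rewrite -{2 4}(rot0 a).
by split=> /rot_inj ?; lra.
Qed.

Lemma nonzero_same_sign (f : R -> R) s t : continuous f -> s <= t ->
  (forall c, s <= c <= t -> f c != 0) -> 0 < f s * f t.
Proof.
move=> cf st fn0; rewrite ltNge; apply/negP => fst.
have [c cst fc] : exists2 c, c \in `[s, t] & f c = 0.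
  apply: IVT => //; first exact: continuous_subspaceT.
  rewrite ge_min le_max.
  by have [] := lerP (f s) 0; have [] := lerP (f t) 0; rewrite ?orbT//=; nra.
by move: cst; rewrite in_itv/= => /fn0; rewrite fc eqxx.
Qed.

(* [z] and [w] lie on a common arc cut off by [x] and [y]; along this arc the
   side of the line through [g x] and [g y] can only change at a zero. *)
Lemma continuous_same_side (g : S1 -> S1) x y z w :
  continuous g -> injective g ->
  0 < orientS x y z * orientS x y w ->
  0 < orientS (g x) (g y) (g z) * orientS (g x) (g y) (g w).
Proof.
have out (r s t : R) : 0 < (s - r) * (t - r) -> ~ s <= r <= t by move=> ?; nra.
move=> cg ig xyzw; have [xy zx zy] := orientS_gt0_neq xyzw.
have [_ wx wy] : [/\ x <> y, w <> x & w <> y].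
  by apply: (@orientS_gt0_neq _ _ _ z); rewrite mulrC.
have gxy : g x <> g y by move=> /ig.
(* Rotating from the antipode of [x] makes [x] the omitted point; with [y] at parameter [s], the two
   open arcs are the parameters below and above [s]. *)
pose b := antipode x; have bx : antipode b = x by exact: antipodeK.
have [s ys] : exists s, y = rot b s by apply: rot_surj; rewrite bx; exact/nesym.
have [t zt] : exists t, z = rot b t by apply: rot_surj; rewrite bx.
have [u wu] : exists u, w = rot b u by apply: rot_surj; rewrite bx.
have oE r : orientS x y (rot b r) = (r - s) * (4 / ((1 + s ^+ 2) * (1 + r ^+ 2))).
  by rewrite ys -bx orient_rot_antipode.
have pos r : 0 < 4 / ((1 + s ^+ 2) * (1 + r ^+ 2)).
  by rewrite divr_gt0// mulr_gt0// sq1_gt0.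
have {xyzw}tus : 0 < (t - s) * (u - s).
  by move: xyzw; rewrite zt wu !oE mulrACA pmulr_lgt0// mulr_gt0.
pose f r := orientS (g x) (g y) (g (rot b r)).
have cf : continuous f.
  move=> r; apply: (continuous_comp (continuous_comp (@rot_continuous _ b r) (cg _))).
  exact: orientS_continuous.
(* By injectivity, [g] can send a point onto the line through [g x] and [g y] only if that point is
   [x], which is not parametrized, or [y]. *)
have f0 r : f r = 0 -> r = s.
  move=> /(orientS_eq0 gxy) fr; suff /eqP : orientS x y (rot b r) = 0.
    by rewrite oE mulf_eq0 subr_eq0 (gt_eqF (pos r)) orbF => /eqP.
  by case: fr => /ig ->; rewrite /orientS ?orientxyx ?orientxyy.
rewrite zt wu -/(f t) -/(f u).
have [tu|/ltW ut] := lerP t u; last (rewrite mulrC; rewrite mulrC in tus).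
  by apply: nonzero_same_sign => // c; apply: contraTneq => /f0 ->; exact/negP/out.
by apply: nonzero_same_sign => // c; apply: contraTneq => /f0 ->; exact/negP/out.
Qed.

(** An arc around [g a] cut off by [x] and [y] contains the image of the open arc around [a] cut off
    by [h x] and [h y]. *)
Lemma same_side_continuous (g h : S1 -> S1) : cancel g h -> cancel h g ->
  (forall x y z w, 0 < orientS x y z * orientS x y w ->
    0 < orientS (g x) (g y) (g z) * orientS (g x) (g y) (g w)) ->
  continuous g.
Proof.
move=> gK hK gside a U /nbhs_arc[x [y [xya arcU]]].
have side0 : orientS (h x) (h y) a != 0.
  have [xy ax ay] : [/\ x <> y, g a <> x & g a <> y].
    by apply: (@orientS_gt0_neq _ _ _ (g a)); rewrite mulr_gt0.
  apply: orientS_neq0 => [/(can_inj hK)//|E|E]; first by rewrite E hK in ax.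
  by rewrite E hK in ay.
have : nbhs a [set z | 0 < orientS (h x) (h y) z * orientS (h x) (h y) a].
  apply: open_nbhs_nbhs; split; first exact: same_side_open.
  by rewrite /= -expr2 exprn_even_gt0.
apply: filterS => z /= /gside; rewrite !hK pmulr_lgt0//.
exact: arcU.
Qed.

End SeparationOfTheCircle.

(** * Incidence, meeting and covering of chords *)

Section Chords.
Variable R : realType.
Local Notation S1 := (S1 R).
Local Notation chord := (chord R).
Implicit Types (a b x y z w : S1) (c d e f : chord).

(** A chord meets the circle only in its endpoints, so this says that [a] is an endpoint of [c]. *)
Definition incident a c := val c (val a).
(** The reflexive closure of adjacency: the sign criterion for intersection then needs no case
    [c = d]. *)
Definition meets c d := val c `&` val d !=set0.
Definition covers d e c := forall f, meets f c -> meets f d \/ meets f e.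

Lemma meetsC c d : meets c d -> meets d c.
Proof. by rewrite /meets setIC. Qed.

Lemma is_chord_segment x y : x <> y -> is_chord (segment (val x) (val y)).
Proof.
move=> /val_neq xy; exists (val x), (val y).
by split=> //; exact: circleP.
Qed.

Lemma chord_exists x y : x <> y -> exists c, has_endpoints c x y.
Proof. by move=> xy; exists (SigSub (mem_set (is_chord_segment xy))). Qed.

Lemma has_endpoints_exists c : exists x y, has_endpoints c x y.
Proof.
have [p [q [up uq pq cE]]] := set_valP c.
by exists (SigSub (mem_set up)), (SigSub (mem_set uq)); split=> // -[].
Qed.

Lemma has_endpointsC c x y : has_endpoints c x y -> has_endpoints c y x.
Proof. by move=> [xy cE]; split; [exact/nesym|rewrite segmentC]. Qed.

Lemma has_endpoints_eq c d x y :
  has_endpoints c x y -> has_endpoints d x y -> c = d.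
Proof. by move=> [_ cE] [_ dE]; apply/val_inj; rewrite cE dE. Qed.

Lemma incident_left c x y : has_endpoints c x y -> incident x c.
Proof. by case=> _ cE; rewrite /incident cE; exact: segment_left. Qed.

Lemma incident_right c x y : has_endpoints c x y -> incident y c.
Proof. by move=> /has_endpointsC/incident_left. Qed.

Lemma incidentE c x y a : has_endpoints c x y -> incident a c -> a = x \/ a = y.
Proof.
move=> [/val_neq xy cE]; rewrite /incident cE.
move=> /(segment_circle (circleP x) (circleP y) (circleP a) xy).
by case=> /circle_eq ->; [left|right].
Qed.

Lemma incident_other a c : incident a c -> exists b, has_endpoints c a b.
Proof.
have [x [y cxy]] := has_endpoints_exists c.
move=> /(incidentE cxy)[->|->]; first by exists y.
by exists x; exact: has_endpointsC.
Qed.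

Lemma incident_endpoints a b c :
  a <> b -> incident a c -> incident b c -> has_endpoints c a b.
Proof.
move=> ab /incident_other[x cax] /(incidentE cax)[E|->//].
by rewrite E in ab.
Qed.

Lemma incident_inj a b c d : c <> d -> incident a c -> incident a d ->
  incident b c -> incident b d -> a = b.
Proof.
move=> cd ac ad bc bd; apply: contrapT => ab; apply: cd.
exact: has_endpoints_eq (incident_endpoints ab ac bc) (incident_endpoints ab ad bd).
Qed.

Lemma meetsE c d x y z w : has_endpoints c x y -> has_endpoints d z w ->
  meets c d <-> orientS x y z * orientS x y w <= 0.
Proof.
move=> [/val_neq xy cE] [/val_neq zw dE]; rewrite /meets cE dE.
by apply: segment_meet => //; exact: circleP.
Qed.

Lemma not_meetsE c d x y z w : has_endpoints c x y -> has_endpoints d z w ->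
  ~ meets c d <-> 0 < orientS x y z * orientS x y w.
Proof.
move=> cxy dzw; rewrite ltNge; split=> [cd|/negP cd].
  by apply/negP; move/(meetsE cxy dzw).
by move/(meetsE cxy dzw).
Qed.

(** If [f] missed both [xz] and [yz], then [x] and [y] would be strictly on the same side of [f] as
    [z], and [f] would miss [xy]. *)
Lemma triangle_covers c d e x y z :
  has_endpoints c x y -> has_endpoints d x z -> has_endpoints e y z ->
  covers d e c.
Proof.
move=> cxy dxz eyz f fc; have [s [t fst]] := has_endpoints_exists f.
apply: contrapT => /not_orP[/(not_meetsE fst dxz) h1 /(not_meetsE fst eyz) h2].
move: fc => /(meetsE fst cxy).
set u := orientS s t x in h1 *; set v := orientS s t y in h2 *.
set r := orientS s t z in h1 h2.
have r0 : r != 0 by apply: contraTneq h1 => ->; rewrite mulr0 ltxx.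
have : 0 < (u * v) * r ^+ 2.
  have -> : u * v * r ^+ 2 = (u * r) * (v * r).
    by ring.
  by rewrite mulr_gt0.
by rewrite pmulr_lgt0 ?exprn_even_gt0// => uv; rewrite leNgt uv.
Qed.

(* A sufficiently short chord at an endpoint of [c] avoids every chord not
   ending there. *)
Lemma covers_incident d e c a :
  covers d e c -> incident a c -> incident a d \/ incident a e.
Proof.
move=> cov ac; apply: contrapT => /not_orP[ad ae].
have near_side f : ~ incident a f -> exists x y, has_endpoints f x y /\
    nbhs a [set z | 0 < orientS x y z * orientS x y a].
  have [x [y fxy]] := has_endpoints_exists f => af; exists x, y; split=> //.
  apply: open_nbhs_nbhs; split; first exact: same_side_open.
  rewrite /= -expr2 exprn_even_gt0//=; apply: orientS_neq0; first by case: fxy.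
    by move=> E; apply: af; rewrite E; exact: incident_left fxy.
  by move=> E; apply: af; rewrite E; exact: incident_right fxy.
have [x [y [dxy nd]]] := near_side _ ad.
have [z [w [ezw ne]]] := near_side _ ae.
have [b ba [db eb]] := nbhs_neq (filterI nd ne).
have [f fba] := chord_exists ba.
have [|/meetsC fd|/meetsC fe] := cov f.
- by exists (val a); split; [exact: incident_right fba|].
- by move: fd; apply/(not_meetsE dxy fba).
- by move: fe; apply/(not_meetsE ezw fba).
Qed.

(** * Bijections of the chords that preserve meeting *)

Section MeetingPreserved.
Variables F G : chord -> chord.
Hypotheses (FK : cancel F G) (GK : cancel G F).
Hypothesis F_meets : forall c d, meets (F c) (F d) <-> meets c d.

Lemma F_covers c d e : covers d e c <-> covers (F d) (F e) (F c).
Proof.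
split=> cov f.
  by rewrite -(GK f) => /F_meets/cov[]/F_meets; [left|right].
by move=> /F_meets/cov[]/F_meets; [left|right].
Qed.

(* Two chords share an endpoint exactly when one of them is covered by the other
   one and a third chord. *)
Lemma F_common a c d : c <> d -> incident a c -> incident a d ->
  exists b, incident b (F c) /\ incident b (F d).
Proof.
move=> cd /incident_other[x cax] /incident_other[y day].
have xy : x <> y by move=> E; rewrite -E in day; exact: cd (has_endpoints_eq cax day).
have [e exy] := chord_exists xy.
have ce : F c <> F e.
  move=> /(can_inj FK) E; have := incident_left cax; rewrite E => /(incidentE exy).
  by case: cax => + _; case: day => + _ => ay ax [].
have /F_covers/covers_incident cov := triangle_covers cax day exy.
have [s [t Fst]] := has_endpoints_exists (F c).
have st : s <> t by case: Fst.
have sc := incident_left Fst; have tc := incident_right Fst.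
(* Each endpoint of [F c] lies on [F d] or [F e]; both cannot lie on [F e], since [F c] and [F e]
   differ. *)
have [sd|se] := cov s sc; first by exists s.
have [td|te] := cov t tc; first by exists t.
by have := incident_inj ce sc se tc te.
Qed.

(* If the image of a chord [e] at [a] missed the common endpoint [m] of the images
   of [c] and [d], these three images would form a triangle; then [c] and [d]
   would cover [e]. *)
Lemma F_star a : exists b, forall e, incident a e -> incident b (F e).
Proof.
have [x [y [xa ya xy]]] := circle_three_points a.
have [c cax] := chord_exists (nesym xa); have [d day] := chord_exists (nesym ya).
have cd : c <> d.
  move=> E; have := incident_right cax; rewrite E => /(incidentE day).
  by case.
have Fcd : F c <> F d by move=> /(can_inj FK).
have [m [mc md]] := F_common cd (incident_left cax) (incident_left day).
exists m => e ae; have [->//|ec] := pselect (e = c); have [->//|ed] := pselect (e = d).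
have [p [pe pc]] := F_common ec ae (incident_left cax).
have [q [qe qd]] := F_common ed ae (incident_left day).
apply: contrapT => me.
have pm : p <> m by move=> E; apply: me; rewrite -E.
have qm : q <> m by move=> E; apply: me; rewrite -E.
have pq : p <> q.
  by move=> E; apply/pm/(incident_inj Fcd) => //; rewrite E.
have /(F_covers _ _ _).2/covers_incident cov : covers (F c) (F d) (F e).
  by apply: (@triangle_covers _ _ _ p q m); exact: incident_endpoints.
(* The endpoint [z] of [e] other than [a] must then lie on [c] or [d], which makes [e] equal to that
   chord. *)
have [z eaz] := incident_other ae; have [az _] := eaz.
case: (cov z (incident_right eaz)).
  move=> /(incidentE cax)[/nesym//|E]; rewrite E in eaz.
  exact: ec (has_endpoints_eq eaz cax).
move=> /(incidentE day)[/nesym//|E]; rewrite E in eaz.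
exact: ed (has_endpoints_eq eaz day).
Qed.

End MeetingPreserved.

(** A point [b] other than [a] would be the far endpoint of two different chords at [a]. *)
Lemma star_center_unique a b :
  (forall e, incident a e -> incident b e) -> a = b.
Proof.
move=> ab; have [x [y [xa ya xy]]] := circle_three_points a.
have [c cax] := chord_exists (nesym xa); have [d day] := chord_exists (nesym ya).
have [//|bx] := incidentE cax (ab _ (incident_left cax)).
by have [//|E] := incidentE day (ab _ (incident_left day)); rewrite -bx in xy.
Qed.

(** The star centers chosen for [F] and for [G] define [g] and [h]; they are mutually inverse
    because a star determines its center. *)
Lemma meets_point_bijection (F G : chord -> chord) :
  cancel F G -> cancel G F -> (forall c d, meets (F c) (F d) <-> meets c d) ->
  exists g h : S1 -> S1, [/\ cancel g h, cancel h g &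
    forall c x y, has_endpoints c x y -> has_endpoints (F c) (g x) (g y)].
Proof.
move=> FK GK FM.
have GM c d : meets (G c) (G d) <-> meets c d by rewrite -{2}(GK c) -{2}(GK d) FM.
have [g gP] := choice (F_star FK GK FM).
have [h hP] := choice (F_star GK FK GM).
have gK : cancel g h.
  by move=> a; apply/esym/star_center_unique => e /gP/hP; rewrite FK.
have hK : cancel h g.
  by move=> a; apply/esym/star_center_unique => e /hP/gP; rewrite GK.
exists g, h; split=> // c x y cxy; have [xy _] := cxy.
apply: incident_endpoints; first by move=> /(can_inj gK).
  exact/gP/(incident_left cxy).
exact/gP/(incident_right cxy).
Qed.

Lemma meets_same_side (F : chord -> chord) (g : S1 -> S1) : injective g ->
  (forall c d, meets (F c) (F d) <-> meets c d) ->
  (forall c x y, has_endpoints c x y -> has_endpoints (F c) (g x) (g y)) ->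
  forall x y z w, 0 < orientS x y z * orientS x y w ->
    0 < orientS (g x) (g y) (g z) * orientS (g x) (g y) (g w).
Proof.
move=> ig FM Fg x y z w side; have [xy zx zy] := orientS_gt0_neq side.
(* No chord joins [z] to itself; in this case the product is a square, nonzero by injectivity. *)
have [<-|zw] := pselect (z = w).
  rewrite -expr2 exprn_even_gt0//=.
  by apply: orientS_neq0 => /ig.
have [c cxy] := chord_exists xy; have [d dzw] := chord_exists zw.
apply/(not_meetsE (Fg _ _ _ cxy) (Fg _ _ _ dzw)) => /FM.
exact/(not_meetsE cxy dzw).
Qed.

End Chords.

(** * Homeomorphisms and the graph automorphisms they induce *)

Section CircleGraphAutomorphisms.
Variable R : realType.
Local Notation S1 := (S1 R).
Local Notation chord := (chord R).
Local Notation graph_aut := (graph_aut (circle_graph R)).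
Implicit Types (c d : chord) (g h : homeo S1) (f : graph_aut).

Lemma homeo_continuous g : continuous g.
Proof. by have /asboolP[] := homeo_bijP g. Qed.

Lemma homeo_inv_continuous g : continuous (bij_inv_fun g).
Proof. by have /asboolP[] := homeo_bijP g. Qed.

Lemma homeo_exists (g h : S1 -> S1) : cancel g h -> cancel h g ->
  continuous g -> continuous h -> exists k : homeo S1, k =1 g.
Proof.
move=> gK hK cg ch.
pose b : bijection S1 := Bijection (asboolT (Bijective gK hK)).
have bh : is_homeo b.
  apply/asboolP; split=> //.
  rewrite (_ : ((b^-1)%g : S1 -> S1) = h)//; apply/funext => a.
  by apply: (can_inj gK); rewrite hK; exact: (bij_invK b).
by exists (Homeo bh).
Qed.

Lemma meets_adj c d : meets c d <-> c = d \/ chord_adj c d.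
Proof.
split=> [cd|[->|[]//]]; first by have [->|?] := pselect (c = d); [left|right].
by have [x [y dxy]] := has_endpoints_exists d; exists (val x); split; exact: incident_left dxy.
Qed.

Lemma graph_aut_inj f : injective f.
Proof. exact: can_inj (bij_funK f). Qed.

Lemma graph_aut_meets f c d : meets (f c) (f d) <-> meets c d.
Proof.
have /asboolP /(_ c d) fA := graph_aut_bijP f.
split=> /meets_adj[E|A]; apply/meets_adj.
- by left; exact: graph_aut_inj E.
- by right; apply/fA.
- by left; rewrite E.
- by right; apply/fA.
Qed.

Lemma graph_aut_exists (F G : chord -> chord) : cancel F G -> cancel G F ->
  (forall c d, meets (F c) (F d) <-> meets c d) -> exists f : graph_aut, f =1 F.
Proof.
move=> FK GK FM.
pose b : bijection chord := Bijection (asboolT (Bijective FK GK)).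
have bA : @is_graph_aut (circle_graph R) b.
  apply/asboolP => c d /=; split=> -[cd I]; split.
  - by move=> E; apply: cd; rewrite E.
  - exact/FM.
  - by move=> /(can_inj FK).
  - exact/FM.
by exists (GraphAut bA).
Qed.

(** The graph of the map [pi], as a relation: its totality, uniqueness and compatibility with
    products can be proved before any function is chosen. *)
Definition induces g f := forall x y c,
  has_endpoints c x y -> has_endpoints (f c) (g x) (g y).

Lemma induces_exists g : exists f, induces g f.
Proof.
pose h := bij_inv_fun g.
have gK : cancel g h := bij_funK g; have hK : cancel h g := bij_invK g.
(* The image chord is chosen from one ordering of the endpoints; any other pair of endpoints is this
   one or its swap. *)
have lift (k : S1 -> S1) : injective k -> exists F : chord -> chord,
    forall c x y, has_endpoints c x y -> has_endpoints (F c) (k x) (k y).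
  move=> ik; suff /choice[F FP] : forall c, exists d,
      forall x y, has_endpoints c x y -> has_endpoints d (k x) (k y) by exists F.
  move=> c; have [x [y cxy]] := has_endpoints_exists c.
  have [|d dxy] := @chord_exists _ (k x) (k y); first by case: cxy => xy _ /ik.
  exists d => z w czw; have [zw _] := czw.
  have zE := incidentE cxy (incident_left czw).
  have wE := incidentE cxy (incident_right czw).
  by case: zE zw => ->; case: wE => -> // _; exact: has_endpointsC.
have [F FP] := lift g (can_inj gK); have [G GP] := lift h (can_inj hK).
have FK : cancel F G.
  move=> c; have [x [y cxy]] := has_endpoints_exists c.
  by have := GP _ _ _ (FP _ _ _ cxy); rewrite !gK => /has_endpoints_eq; exact.
have GK : cancel G F.
  move=> c; have [x [y cxy]] := has_endpoints_exists c.
  by have := FP _ _ _ (GP _ _ _ cxy); rewrite !hK => /has_endpoints_eq; exact.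
(* Continuous injections carry disjoint chords to disjoint chords. This gives one implication for
   [g]; the converse comes from its inverse [h]. *)
have meets_lift (k : S1 -> S1) (H : chord -> chord) : continuous k -> injective k ->
    (forall c x y, has_endpoints c x y -> has_endpoints (H c) (k x) (k y)) ->
    forall c d, meets (H c) (H d) -> meets c d.
  move=> ck ik HP c d; have [x [y cxy]] := has_endpoints_exists c.
  have [z [w dzw]] := has_endpoints_exists d.
  move=> Hcd; apply: contrapT => /(not_meetsE cxy dzw) side.
  by move: Hcd; apply/(not_meetsE (HP _ _ _ cxy) (HP _ _ _ dzw))/continuous_same_side.
have [|f fE] := @graph_aut_exists F G FK GK.
  have MF := meets_lift g F (@homeo_continuous g) (can_inj gK) FP.
  have MG := meets_lift h G (@homeo_inv_continuous g) (can_inj hK) GP.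
  move=> c d; split; first exact: MF.
  by move=> cd; apply: MG; rewrite !FK.
by exists f => x y c cxy; rewrite fE; exact: FP.
Qed.

Lemma induces_unique g f f' : induces g f -> induces g f' -> f = f'.
Proof.
move=> gf gf'; apply/val_inj/bijectionP => c /=.
have [x [y cxy]] := has_endpoints_exists c.
exact: has_endpoints_eq (gf _ _ _ cxy) (gf' _ _ _ cxy).
Qed.

Lemma inducesM g h f f' : induces g f -> induces h f' -> induces (g * h)%g (f * f')%g.
Proof. by move=> gf hf' x y c /hf'/gf. Qed.

(** Two different chords at [a] have different images under [f], whose only common endpoint is both
    [g a] and [h a]. *)
Lemma induces_inj g h f : induces g f -> induces h f -> g = h.
Proof.
move=> gf hf; apply/val_inj/bijectionP => a /=.
have [x [y [xa ya xy]]] := circle_three_points a.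
have [c cax] := chord_exists (nesym xa); have [d day] := chord_exists (nesym ya).
apply: (@incident_inj _ (g a) (h a) (f c) (f d)).
- move=> /graph_aut_inj E; have := incident_right cax.
  by rewrite E => /(incidentE day)[].
- exact: incident_left (gf _ _ _ cax).
- exact: incident_left (gf _ _ _ day).
- exact: incident_left (hf _ _ _ cax).
- exact: incident_left (hf _ _ _ day).
Qed.

Lemma induces_surj f : exists g, induces g f.
Proof.
have fK : cancel f (bij_inv_fun f) := bij_funK f.
have fVK : cancel (bij_inv_fun f) f := bij_invK f.
have [g [h [gK hK fP]]] := meets_point_bijection fK fVK (graph_aut_meets f).
have fVM c d : meets (bij_inv_fun f c) (bij_inv_fun f d) <-> meets c d.
  by rewrite -(graph_aut_meets f) !fVK.
(* The inverse automorphism is induced by [h]: the endpoints [x], [y] of [c] are, in some order, the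
   images under [g] of those of its preimage. Continuity of [h] then follows as for [g]. *)
have fVP c x y : has_endpoints c x y -> has_endpoints (bij_inv_fun f c) (h x) (h y).
  move=> cxy; have [z [w czw]] := has_endpoints_exists (bij_inv_fun f c).
  have := fP _ _ _ czw; rewrite fVK => cgg.
  have [xy _] := cxy.
  have := incidentE cgg (incident_left cxy); have := incidentE cgg (incident_right cxy).
  by case=> yE [] xE; move: xy; rewrite xE yE ?gK// => _; exact: has_endpointsC.
have cg : continuous g.
  apply: (same_side_continuous gK hK).
  exact: (meets_same_side (can_inj gK) (graph_aut_meets f) fP).
have ch : continuous h.
  apply: (same_side_continuous hK gK).
  exact: (meets_same_side (can_inj hK) fVM fVP).
have [k kE] := homeo_exists gK hK cg ch.
by exists k => x y c; rewrite !kE; exact: fP.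
Qed.

End CircleGraphAutomorphisms.

Theorem theorem1p1 (R : realType) :
  exists pi : homeo (S1 R) -> graph_aut (circle_graph R),
    unique (@induced_on_chords R) pi /\ group_isomorphism pi.
Proof.
have [phi phiP] := choice (@induces_exists R).
exists phi; split; first split=> [|psi psiP].
- exact: phiP.
- by apply/funext => g; apply: (@induces_unique _ g); [exact: phiP|exact: psiP].
split=> [g h|].
  by apply: (@induces_unique _ (g * h)%g); [exact: phiP|apply: inducesM; exact: phiP].
(* A homeomorphism chosen for each automorphism gives the inverse map, since each side of the
   relation determines the other. *)
have [psi psiP] := choice (@induces_surj R).
exists psi => [g|f].
  by apply: (@induces_inj _ _ _ (phi g)); [exact: psiP|exact: phiP].
by apply: (@induces_unique _ (psi f)); [exact: phiP|exact: psiP].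
Qed.
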